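(* If $(A,\mathfrak{m})$ is a regular local ring, then $(ic(A),* )$ is a bounded factorization monoid (BFM).
   Context: For an ideal $I$ of a commutative Noetherian ring $A$, the integral closure is $\overline{I}=\{x\in A : x^n+a_1x^{n-1}+\dots+a_n=0 \text{ for some } n\ge 1,\ a_i\in I^i\}$; $I$ is integrally closed if $\overline{I}=I$. Define $ic(A)=\{I : I \text{ is an integrally closed ideal of } A \text{ containing a nonzerodivisor}\}$, with operation $I*J=\overline{IJ}$; this is a commutative monoid with identity $(1)$ whose only invertible element is $(1)$. In such a monoid $M$ (written multiplicatively with identity $1$), an atom is an element $a\neq 1$ such that $a=xy$ implies $x=1$ or $y=1$. $M$ is atomic if it is generated by its atoms. An atomic monoid $M$ is a bounded factorization monoid if for every $m\in M$ the set $L(m)=\{k : m=m_1m_2\cdots m_k \text{ for atoms } m_i\}$ is finite. *)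

(* Defs.v *)
From HB Require Import structures.
From mathcomp Require Import all_boot all_order all_algebra.
From mathcomp Require Import all_classical.

Set Implicit Arguments.
Unset Strict Implicit.
Unset Printing Implicit Defensive.

Import GRing.Theory.

Local Open Scope classical_set_scope.
Local Open Scope ring_scope.

(* Ideals are arbitrary Prop-valued subsets, and the unit ideal is allowed,
   unlike the decidable proper ideals of ring_quotient. *)
Definition ideal (A : comNzRingType) (I : set A) : Prop :=
  [/\ I 0, (forall x y, I x -> I y -> I (x + y))
    & (forall c x, I x -> I (c * x))].

Definition ideal_gen (A : comNzRingType) (S : set A) : set A :=
  smallest (@ideal A) S.

Definition ideal_mul (A : comNzRingType) (I J : set A) : set A :=
  ideal_gen [set z | exists x y, [/\ I x, J y & z = x * y]].

Definition ideal_exp (A : comNzRingType) (I : set A) (n : nat) : set A :=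
  iter n (ideal_mul I) setT.

(* Only the coefficients a 1, ..., a n matter. *)
Definition integral_closure (A : comNzRingType) (I : set A) : set A :=
  [set x | exists n (a : nat -> A),
    [/\ (0 < n)%N, (forall i, (1 <= i <= n)%N -> ideal_exp I i (a i))
      & x ^+ n + \sum_(1 <= i < n.+1) a i * x ^+ (n - i) = 0]].

Definition noetherian (A : comNzRingType) : Prop :=
  forall I : set A, ideal I -> exists s : seq A, I = ideal_gen [set` s].

Definition prime_ideal (A : comNzRingType) (P : set A) : Prop :=
  [/\ ideal P, ~ P 1 & forall x y, P (x * y) -> P x \/ P y].

Definition maximal_ideal (A : comNzRingType) (M : set A) : Prop :=
  [/\ ideal M, M != setT
    & forall J, ideal J -> M `<=` J -> J = M \/ J = setT].

(* P 0 < P 1 < ... < P d; the values P i with i > d are irrelevant. *)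
Definition prime_chain (A : comNzRingType) (P : nat -> set A) (d : nat) :
    Prop :=
  (forall i, (i <= d)%N -> prime_ideal (P i)) /\
  (forall i, (i < d)%N -> P i `<` P i.+1).

Definition has_krull_dim (A : comNzRingType) (d : nat) : Prop :=
  (exists P : nat -> set A, prime_chain P d) /\
  (forall (P : nat -> set A) e, prime_chain P e -> (e <= d)%N).

Definition min_generators (A : comNzRingType) (I : set A) (d : nat) : Prop :=
  (exists2 s : seq A, size s = d & I = ideal_gen [set` s]) /\
  (forall s : seq A, I = ideal_gen [set` s] -> (d <= size s)%N).

(* The minimal number of generators of m equals the Krull dimension. *)
Definition regular_local (A : comNzRingType) (m : set A) : Prop :=
  [/\ noetherian A, maximal_ideal m, (forall n, maximal_ideal n -> n = m)
    & exists d, has_krull_dim A d /\ min_generators m d].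

Definition commutative_monoid (M : monoidType) : Prop :=
  forall x y : M, (x * y = y * x)%g.

Definition reduced_monoid (M : monoidType) : Prop :=
  forall x y : M, (x * y = 1)%g -> x = 1%g.

Definition atom (M : monoidType) (a : M) : Prop :=
  a <> 1%g /\ forall x y : M, a = (x * y)%g -> x = 1%g \/ y = 1%g.

Definition atomic_factorization (M : monoidType) (m : M) (s : seq M) : Prop :=
  (forall a, a \in s -> atom a) /\ m = (\prod_(a <- s) a)%g.

Definition atomic (M : monoidType) : Prop :=
  forall m : M, exists s, atomic_factorization m s.

(* The empty factorization is allowed, so 1 has the length 0. *)
Definition factorization_lengths (M : monoidType) (m : M) : set nat :=
  [set k | exists2 s, atomic_factorization m s & size s = k].

(* Atoms are only considered in commutative monoids whose sole invertible
   element is 1; both conditions are part of the predicate. *)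
Definition BFM (M : monoidType) : Prop :=
  [/\ commutative_monoid M, reduced_monoid M, atomic M
    & forall m : M, finite_set (factorization_lengths m)].

Lemma ideal_setT (A : comNzRingType) : @ideal A setT.
Proof. by []. Qed.

Lemma ideal_opp (A : comNzRingType) (I : set A) x : ideal I -> I x -> I (- x).
Proof. by move=> [_ _ IM] Ix; rewrite -mulN1r; apply: IM. Qed.

Lemma ideal_ideal_gen (A : comNzRingType) (S : set A) : ideal (ideal_gen S).
Proof.
split.
- by move=> I [[]].
- move=> x y Hx Hy I HI; have [[_ ID _] _] := HI.
  by apply: ID; [apply: Hx|apply: Hy].
- by move=> c x Hx I HI; have [[_ _ IM] _] := HI; apply: IM; apply: Hx.
Qed.

Lemma ideal_gen_sub (A : comNzRingType) (S I : set A) :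
  ideal I -> S `<=` I -> ideal_gen S `<=` I.
Proof. by move=> II SI; apply: smallest_sub. Qed.

Lemma ideal_ideal_mul (A : comNzRingType) (I J : set A) :
  ideal (ideal_mul I J).
Proof. exact: ideal_ideal_gen. Qed.

Lemma ideal_ideal_exp (A : comNzRingType) (I : set A) n : ideal (ideal_exp I n).
Proof. by case: n => [|n]; [exact: ideal_setT | exact: ideal_ideal_mul]. Qed.

Lemma mem_ideal_mul (A : comNzRingType) (I J : set A) x y :
  I x -> J y -> ideal_mul I J (x * y).
Proof. by move=> Ix Jy; apply: sub_gen_smallest; exists x, y. Qed.

Lemma ideal_mul_sub (A : comNzRingType) (I J K : set A) :
  ideal K -> (forall x y, I x -> J y -> K (x * y)) -> ideal_mul I J `<=` K.
Proof.
by move=> IK IJK; apply: ideal_gen_sub => // _ [x [y [Ix Jy ->]]]; apply: IJK.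
Qed.

Lemma ideal_mulS (A : comNzRingType) (I J I' J' : set A) :
  I `<=` I' -> J `<=` J' -> ideal_mul I J `<=` ideal_mul I' J'.
Proof.
move=> II' JJ'; apply: ideal_mul_sub; first exact: ideal_ideal_mul.
by move=> x y /II' Ix /JJ' Jy; apply: mem_ideal_mul.
Qed.

Lemma ideal_mulC (A : comNzRingType) (I J : set A) :
  ideal_mul I J = ideal_mul J I.
Proof.
by apply/seteqP; split; apply: ideal_mul_sub;
  do ?[exact: ideal_ideal_mul] => x y Ix Jy; rewrite mulrC; apply: mem_ideal_mul.
Qed.

Lemma ideal_colon (A : comNzRingType) (I : set A) y :
  ideal I -> ideal [set x | I (x * y)].
Proof.
move=> [I0 ID IM]; split=> /= [|x z Hx Hz|c x Hx]; first by rewrite mul0r.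
  by rewrite mulrDl; apply: ID.
by rewrite -mulrA; apply: IM.
Qed.

Lemma ideal_mulA_sub (A : comNzRingType) (I J K : set A) :
  ideal_mul (ideal_mul I J) K `<=` ideal_mul I (ideal_mul J K).
Proof.
apply: ideal_mul_sub; first exact: ideal_ideal_mul.
move=> x z + Kz; move: x; apply: ideal_mul_sub => [|x y Ix Jy].
  by apply: ideal_colon; exact: ideal_ideal_mul.
by rewrite /= -mulrA; do 2!apply: mem_ideal_mul => //.
Qed.

Lemma ideal_mulA (A : comNzRingType) (I J K : set A) :
  ideal_mul I (ideal_mul J K) = ideal_mul (ideal_mul I J) K.
Proof.
apply/seteqP; split; last exact: ideal_mulA_sub.
by rewrite (ideal_mulC I) (ideal_mulC J) (ideal_mulC _ K) (ideal_mulC I J);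
  exact: ideal_mulA_sub.
Qed.

Lemma ideal_mulT (A : comNzRingType) (I : set A) :
  ideal I -> ideal_mul setT I = I.
Proof.
move=> II; apply/seteqP; split.
  by apply: ideal_mul_sub => // x y _; case: II => _ _; apply.
by move=> x Ix; rewrite -[x]mul1r; apply: mem_ideal_mul.
Qed.

Lemma ideal_mul_subr (A : comNzRingType) (I J : set A) :
  ideal I -> ideal_mul I J `<=` I.
Proof.
move=> II; apply: ideal_mul_sub => // x y Ix _; rewrite mulrC.
by case: II => _ _; apply.
Qed.

Lemma ideal_expS (A : comNzRingType) (I J : set A) n :
  I `<=` J -> ideal_exp I n `<=` ideal_exp J n.
Proof. by move=> IJ; elim: n => [//|n IHn]; apply: ideal_mulS. Qed.

Lemma ideal_exp1 (A : comNzRingType) (I : set A) :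
  ideal I -> ideal_exp I 1 = I.
Proof. by move=> II; rewrite /ideal_exp /= ideal_mulC ideal_mulT. Qed.

Lemma mem_ideal_expD (A : comNzRingType) (I : set A) i j x y :
  ideal_exp I i x -> ideal_exp I j y -> ideal_exp I (i + j) (x * y).
Proof.
move=> + Hy; elim: i x => [|i IHi].
  by move=> x _; case: (ideal_ideal_exp I j) => _ _; apply.
apply: ideal_mul_sub => [|u b Iu Hb].
  exact: ideal_colon (ideal_ideal_exp _ _).
by rewrite /= -mulrA; apply: mem_ideal_mul => //; apply: IHi.
Qed.

Lemma mem_ideal_exp_mul (A : comNzRingType) (I J : set A) i x y :
  ideal_exp I i x -> J y -> ideal_exp (ideal_mul I J) i (x * y ^+ i).
Proof.
move=> + Jy; elim: i x => [//|i IHi].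
apply: ideal_mul_sub => [|u b Iu Hb].
  exact: ideal_colon (ideal_ideal_exp _ _).
by rewrite /= exprS mulrACA; apply: mem_ideal_mul; [apply: mem_ideal_mul|apply: IHi].
Qed.

(* The Rees algebra of I, as a subring of {poly A}: x lies in the integral
   closure of I iff x * 'X is integral over it. *)

Definition rees_pred (A : comNzRingType) (I : set A) : {pred {poly A}} :=
  [pred p : {poly A} | `[< forall i, ideal_exp I i p`_i >]].

Lemma rees_predP (A : comNzRingType) (I : set A) (p : {poly A}) :
  reflect (forall i, ideal_exp I i p`_i) (p \in rees_pred I).
Proof. by rewrite inE; apply: asboolP. Qed.

Lemma rees_subring (A : comNzRingType) (I : set A) :
  subring_closed (rees_pred I).
Proof.
split=> [|p q /rees_predP Hp /rees_predP Hq|p q /rees_predP Hp /rees_predP Hq];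
  apply/rees_predP => i.
- rewrite coef1; case: i => [//|i] /=.
  by case: (ideal_ideal_exp I i.+1).
- have II := ideal_ideal_exp I i; rewrite coefB.
  by have [_ ID _] := II; apply: ID => //; apply: ideal_opp.
rewrite coefM; have [I0 ID _] := ideal_ideal_exp I i.
apply: (big_ind (ideal_exp I i)) => // j _.
rewrite -[i in ideal_exp I i](subnKC (_ : j <= i)%N); last by rewrite -ltnS.
exact: mem_ideal_expD.
Qed.

HB.instance Definition _ (A : comNzRingType) (I : set A) :=
  GRing.isSubringClosed.Build {poly A} (rees_pred I) (rees_subring I).

Record rees (A : comNzRingType) (I : set A) :=
  Rees { rees_val :> {poly A}; _ : rees_val \in rees_pred I }.

HB.instance Definition _ (A : comNzRingType) (I : set A) :=
  [isSub for @rees_val A I].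
HB.instance Definition _ (A : comNzRingType) (I : set A) :=
  [Choice of rees I by <:].
HB.instance Definition _ (A : comNzRingType) (I : set A) :=
  [SubChoice_isSubComNzRing of rees I by <:].

Definition rees_integral (A : comNzRingType) (I : set A) (p : {poly A}) :=
  integralOver (val : rees I -> {poly A}) p.

Lemma rees_integral_mem (A : comNzRingType) (I : set A) (p : {poly A}) :
  p \in rees_pred I -> rees_integral I p.
Proof.
move=> Hp; have -> : p = val (Rees Hp) by [].
exact: (integral_id (val : {rmorphism rees I -> {poly A}})).
Qed.

Lemma rees_integralC (A : comNzRingType) (I : set A) (c : A) :
  rees_integral I c%:P.
Proof.
apply: rees_integral_mem; apply/rees_predP => i; rewrite coefC.
by case: i => [//|i] /=; case: (ideal_ideal_exp I i.+1).
Qed.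

Lemma rees_integralD (A : comNzRingType) (I : set A) (p q : {poly A}) :
  rees_integral I p -> rees_integral I q -> rees_integral I (p + q).
Proof. exact: (@integral_add _ _ (val : {rmorphism rees I -> {poly A}})). Qed.

Lemma rees_integralM (A : comNzRingType) (I : set A) (p q : {poly A}) :
  rees_integral I p -> rees_integral I q -> rees_integral I (p * q).
Proof. exact: (@integral_mul _ _ (val : {rmorphism rees I -> {poly A}})). Qed.

Lemma rees_integral_exp (A : comNzRingType) (I J : set A) n a :
    (forall y, J y -> rees_integral I (y%:P * 'X)) ->
  ideal_exp J n a -> rees_integral I (a%:P * 'X^n).
Proof.
move=> HJ; elim: n a => [|n IHn].
  by move=> a _; rewrite expr0 mulr1; apply: rees_integralC.
apply: ideal_mul_sub => [|u b Ju Hb].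
  split=> /= [|x y Hx Hy|c x Hx].
  - by rewrite mul0r; apply: rees_integralC 0.
  - by rewrite polyCD mulrDl; apply: rees_integralD.
  - by rewrite polyCM -mulrA; apply: rees_integralM => //; apply: rees_integralC.
by rewrite polyCM exprS mulrACA; apply: rees_integralM; [apply: HJ|apply: IHn].
Qed.

Lemma rees_integral_closure (A : comNzRingType) (I J : set A) x :
    (forall y, J y -> rees_integral I (y%:P * 'X)) ->
  integral_closure J x -> rees_integral I (x%:P * 'X).
Proof.
move=> HJ [n [a [n_gt0 Ha xn]]].
pose E i : {poly A} := (a (n - i)%N)%:P * 'X^(n - i).
pose p : {poly {poly A}} := 'X^n + \poly_(i < n) E i.
have szE : (size (\poly_(i < n) E i)%R <= n)%N by apply: size_poly.
apply: (@integral_root_monic _ _ (val : {rmorphism rees I -> {poly A}}) _ p).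
- by rewrite monicE lead_coefDl ?lead_coefXn // size_polyXn ltnS.
- apply/rootP; rewrite /p hornerD hornerXn horner_poly exprMn.
  have -> : \sum_(i < n) E i * (x%:P * 'X) ^+ i =
            \sum_(i < n) ((a (n - i)%N * x ^+ i)%:P * 'X^n).
    apply: eq_bigr => i _.
    rewrite /E exprMn mulrACA -exprD subnK; last exact: ltnW.
    by rewrite polyCM polyC_exp.
  rewrite -mulr_suml -polyC_exp -mulrDl -rmorph_sum -polyCD.
  suff -> : \sum_(i < n) a (n - i)%N * x ^+ i =
            \sum_(1 <= i < n.+1) a i * x ^+ (n - i) by rewrite xn mul0r.
  rewrite big_add1 /= big_mkord (reindex_inj rev_ord_inj) /=.
  apply: eq_bigr => i _; rewrite subKn //.
- apply/integral_poly => i; rewrite coefD coefXn coef_poly.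
  apply: rees_integralD; first by case: eqP => _; apply: rees_integralC.
  case: ifP => [lt_in|_]; last exact: rees_integralC 0.
  apply: (rees_integral_exp HJ); apply: Ha.
  by rewrite subn_gt0 lt_in leq_subr.
Qed.

Lemma rees_integral_mem1 (A : comNzRingType) (I : set A) x :
  ideal I -> I x -> rees_integral I (x%:P * 'X).
Proof.
move=> II Ix; apply: rees_integral_mem; apply/rees_predP => i.
rewrite coefCM coefX; case: i => [|[|i]] //=.
  by rewrite mulr1; move: Ix; rewrite -{1}(ideal_exp1 II).
by rewrite mulr0; case: (ideal_ideal_exp I i.+2).
Qed.

Lemma closure_rees_integral (A : comNzRingType) (I : set A) x :
  rees_integral I (x%:P * 'X) -> integral_closure I x.
Proof.
move=> [p mon_p /rootP px].
have n_gt0 : (0 < (size p).-1)%N.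
  rewrite lt0n; apply/eqP => sz_p.
  have p_n0 : size p != 0%N by rewrite size_poly_eq0 monic_neq0.
  have p1 : p = 1.
    have := mon_p; rewrite (size1_polyC (_ : size p <= 1)%N); last first.
      by case: (size p) sz_p p_n0 => [|[]].
    by rewrite monicE lead_coefC => /eqP ->.
  by move/eqP: px; rewrite p1 rmorph1 hornerE oner_eq0.
set n := (size p).-1 in n_gt0.
have szp : size p = n.+1.
  by rewrite prednK // lt0n size_poly_eq0 monic_neq0.
exists n, (fun i => (val p`_(n - i)%N)`_i); split=> // [i _|].
  exact: (rees_predP _ _ (valP (p`_(n - i)%N))).
move/(congr1 (fun q : {poly A} => q`_n)): px.
rewrite (@horner_coef_wide _ n.+1); last first.
  by rewrite -szp; apply: size_poly.
have cE i : (i <= n)%N ->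
    ((map_poly (val : rees I -> {poly A}) p)`_i * (x%:P * 'X) ^+ i)`_n =
    (val p`_i)`_(n - i) * x ^+ i.
  move=> le_in; rewrite coef_map /= exprMn -polyC_exp mulrA coefMXn.
  by rewrite ltnNge le_in /= coefMC.
have pn1 : p`_n = 1 by move/eqP: mon_p; rewrite /lead_coef.
rewrite coef0 coef_sum (eq_bigr _ (fun i _ => cE (nat_of_ord i) (leq_ord i))).
rewrite big_ord_recr /= subnn pn1 coef1 /= mul1r addrC => px.
rewrite -[RHS]px; congr (_ + _).
rewrite big_add1 /= big_mkord (reindex_inj rev_ord_inj) /=.
by apply: eq_bigr => i _; rewrite subnSK // subKn //; apply: ltnW.
Qed.

Lemma integral_closureP (A : comNzRingType) (I : set A) x :
  ideal I -> integral_closure I x <-> rees_integral I (x%:P * 'X).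
Proof.
move=> II; split; last exact: closure_rees_integral.
by apply: rees_integral_closure => y; apply: rees_integral_mem1.
Qed.

Lemma ideal_integral_closure (A : comNzRingType) (I : set A) :
  ideal I -> ideal (integral_closure I).
Proof.
move=> II; split=> [|x y /(integral_closureP _ II) Hx /(integral_closureP _ II) Hy
                    |c x /(integral_closureP _ II) Hx];
  apply/(integral_closureP _ II).
- by rewrite mul0r; apply: rees_integralC 0.
- by rewrite polyCD mulrDl; apply: rees_integralD.
- by rewrite polyCM -mulrA; apply: rees_integralM => //; apply: rees_integralC.
Qed.

Lemma integral_closureK (A : comNzRingType) (I : set A) :
  ideal I -> integral_closure (integral_closure I) `<=` integral_closure I.
Proof.
move=> II x Hx; apply: closure_rees_integral.
by apply: rees_integral_closure Hx => y /(integral_closureP _ II).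
Qed.

Lemma sub_integral_closure (A : comNzRingType) (I : set A) :
  ideal I -> I `<=` integral_closure I.
Proof. by move=> II x Ix; apply/integral_closureP/rees_integral_mem1. Qed.

Lemma integral_closureS (A : comNzRingType) (I J : set A) :
  I `<=` J -> integral_closure I `<=` integral_closure J.
Proof.
move=> IJ x [n [a [n_gt0 Ha xn]]]; exists n, a; split=> // i /Ha.
exact: ideal_expS.
Qed.

Lemma integral_closure_mul (A : comNzRingType) (I J : set A) :
  ideal_mul (integral_closure I) J `<=` integral_closure (ideal_mul I J).
Proof.
apply: ideal_mul_sub.
  exact/ideal_integral_closure/ideal_ideal_mul.
move=> x y [n [a [n_gt0 Ha xn]]] Jy.
exists n, (fun i => a i * y ^+ i); split=> // [i /Ha Hai|].
  exact: mem_ideal_exp_mul.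
transitivity ((x ^+ n + \sum_(1 <= i < n.+1) a i * x ^+ (n - i)) * y ^+ n).
  rewrite mulrDl exprMn; congr (_ + _); rewrite mulr_suml !big_nat.
  apply: eq_bigr => i /andP[_ le_in]; rewrite exprMn.
  have -> : y ^+ n = y ^+ i * y ^+ (n - i) by rewrite -exprD subnKC.
  by rewrite mulrACA.
by rewrite xn mul0r.
Qed.

(* In a commutative ring GRing.lreg says that x is a nonzerodivisor. *)
Record ic (A : comNzRingType) := IC {
  ic_set :> set A;
  ic_ideal : ideal ic_set;
  ic_closed : integral_closure ic_set = ic_set;
  ic_regular : exists2 x, ic_set x & GRing.lreg x
}.

HB.instance Definition _ (A : comNzRingType) := gen_eqMixin (ic A).
HB.instance Definition _ (A : comNzRingType) := gen_choiceMixin (ic A).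

Lemma ic_inj (A : comNzRingType) : injective (@ic_set A).
Proof.
move=> [I i1 i2 i3] [J j1 j2 j3] /= eIJ; case: J / eIJ j1 j2 j3 => j1 j2 j3.
by congr IC; apply: Prop_irrelevance.
Qed.

Lemma ic_mul_ideal (A : comNzRingType) (I J : ic A) :
  ideal (integral_closure (ideal_mul I J)).
Proof. exact/ideal_integral_closure/ideal_ideal_mul. Qed.

Lemma ic_mul_closed (A : comNzRingType) (I J : ic A) :
  integral_closure (integral_closure (ideal_mul I J)) =
  integral_closure (ideal_mul I J).
Proof.
apply/seteqP; split; first exact/integral_closureK/ideal_ideal_mul.
exact/sub_integral_closure/ic_mul_ideal.
Qed.

Lemma ic_mul_regular (A : comNzRingType) (I J : ic A) :
  exists2 x, integral_closure (ideal_mul I J) x & GRing.lreg x.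
Proof.
have [x Ix xr] := ic_regular I; have [y Jy yr] := ic_regular J.
exists (x * y); last exact: lregM.
by apply: sub_integral_closure; [exact: ideal_ideal_mul|exact: mem_ideal_mul].
Qed.

Definition ic_mul (A : comNzRingType) (I J : ic A) : ic A :=
  IC (ic_mul_ideal I J) (ic_mul_closed I J) (ic_mul_regular I J).

Lemma ic_one_closed (A : comNzRingType) : integral_closure [set: A] = setT.
Proof.
by apply/seteqP; split=> // x _; apply: sub_integral_closure.
Qed.

Lemma ic_one_regular (A : comNzRingType) : exists2 x : A, setT x & GRing.lreg x.
Proof. by exists 1 => //; apply: lreg1. Qed.

Definition ic_one (A : comNzRingType) : ic A :=
  IC (ideal_setT A) (ic_one_closed A) (ic_one_regular A).

Lemma ic_mulC (A : comNzRingType) : commutative (@ic_mul A).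
Proof. by move=> I J; apply: ic_inj; rewrite /= ideal_mulC. Qed.

Lemma ic_mul_mulr (A : comNzRingType) (I J K : ic A) :
  ic_mul (ic_mul I J) K =
  integral_closure (ideal_mul (ideal_mul I J) K) :> set A.
Proof.
apply/seteqP; split=> /=.
  move=> x /(integral_closureS (@integral_closure_mul _ _ _)).
  by apply: integral_closureK; exact: ideal_ideal_mul.
apply: integral_closureS; apply: ideal_mulS => //.
by apply: sub_integral_closure; exact: ideal_ideal_mul.
Qed.

Lemma ic_mulA (A : comNzRingType) : associative (@ic_mul A).
Proof.
move=> I J K; apply: ic_inj; rewrite ic_mul_mulr ic_mulC ic_mul_mulr.
by rewrite ideal_mulC ideal_mulA.
Qed.

Lemma ic_mul1 (A : comNzRingType) : left_id (ic_one A) (@ic_mul A).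
Proof.
move=> I; apply: ic_inj; rewrite /= ideal_mulT; last exact: ic_ideal.
exact: ic_closed.
Qed.

Lemma ic_mulr1 (A : comNzRingType) : right_id (ic_one A) (@ic_mul A).
Proof. by move=> I; rewrite ic_mulC ic_mul1. Qed.

HB.instance Definition _ (A : comNzRingType) :=
  isMonoid.Build (ic A) (@ic_mulA A) (@ic_mul1 A) (@ic_mulr1 A).

Lemma ic_commutative (A : comNzRingType) : commutative_monoid (ic A).
Proof. exact: ic_mulC. Qed.

Lemma ic_reduced (A : comNzRingType) : reduced_monoid (ic A).
Proof.
move=> I J /(congr1 (@ic_set A)) /= IJ1; apply: ic_inj => /=.
apply/seteqP; split=> // x _; rewrite -(ic_closed I).
have : integral_closure (ideal_mul I J) x by rewrite IJ1.
by apply: integral_closureS; apply: ideal_mul_subr; exact: ic_ideal.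
Qed.

(* Main.v *)
(* A factorization of I into k proper ideals puts I inside the integral closure
   of m^k, so it suffices that a nonzerodivisor x lies outside the integral
   closure of some power of m. By Artin-Rees, (m^(n + c) : x) is contained in
   m^n for some c. Let f(n) be the length of A/m^n. Filtering A/m^n by the
   powers of x gives f(n) <= j (f(n) - f(n - c)) whenever x^j is in m^n. Let m
   have r generators. If x is integral over m^(c (r + 1)), then
   j = n / (c (r + 1)) + O(1) is possible, which forces f to grow at least like
   n^(r + 1), contradicting f(n) <= n^r. *)

Require Import Defs.
From mathcomp Require Import all_boot all_order all_algebra.
From mathcomp Require Import all_classical.
From mathcomp Require Import zify.

Set Implicit Arguments.
Unset Strict Implicit.
Unset Printing Implicit Defensive.

Import GRing.Theory.

Local Open Scope classical_set_scope.
Local Open Scope ring_scope.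

(** * Ascending chain condition and Hilbert's basis theorem *)

Lemma chain_le (T : Type) (F : nat -> set T) i j :
  (forall n, F n `<=` F n.+1) -> (i <= j)%N -> F i `<=` F j.
Proof.
move=> FS /subnKC <-; elim: (j - i)%N => [|k IHk]; first by rewrite addn0.
by rewrite addnS => x /IHk /FS.
Qed.

Definition ideal_acc (A : comNzRingType) : Prop :=
  forall F : nat -> set A, (forall n, ideal (F n)) ->
    (forall n, F n `<=` F n.+1) ->
  exists N, forall n, F n `<=` F N.

Lemma noetherian_acc (A : comNzRingType) : noetherian A -> ideal_acc A.
Proof.
move=> noethA F idF FS.
pose U := [set x | exists n, F n x].
have idU : ideal U.
  split=> [|x y [i Hx] [j Hy]|c x [i Hx]].
  - by exists 0%N; case: (idF 0%N).
  - exists (maxn i j); have [_ FD _] := idF (maxn i j).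
    by apply: FD; [move: Hx|move: Hy]; apply: (chain_le FS); lia.
  - by exists i; case: (idF i) => _ _; apply.
have [s Us] := noethA U idU.
have sU x : x \in s -> U x by rewrite Us => xs; apply: sub_gen_smallest.
have [N sN] : exists N, forall x, x \in s -> F N x.
  elim: s {Us} sU => [|x s IHs] sU; first by exists 0%N.
  have [|N HN] := IHs; first by move=> y ys; apply: sU; rewrite inE ys orbT.
  have [k Hk] := sU x (mem_head _ _).
  exists (maxn N k) => y; rewrite inE => /orP[/eqP ->|/HN Hy].
    by move: Hk; apply: (chain_le FS); lia.
  by move: Hy; apply: (chain_le FS); lia.
exists N => n x Fx; have : U x by exists n.
by rewrite Us; apply: ideal_gen_sub.
Qed.

(** Without a maximal element, choice gives a strictly larger member above each one, and iterating
    contradicts the chain condition. *)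
Lemma acc_maximal (A : comNzRingType) (P : set A -> Prop) (I : set A) :
    ideal_acc A -> (forall J, P J -> ideal J) -> P I ->
  exists2 M, P M /\ I `<=` M & forall J, P J -> M `<=` J -> J = M.
Proof.
move=> accA idP PI; apply: contrapT => noM.
have step (J : {J | P J /\ I `<=` J}) :
    exists K : {K | P K /\ I `<=` K}, sval J `<` sval K.
  case: J => J [PJ IJ] /=; apply: contrapT => noK; apply: noM.
  exists J => // K PK JK; apply/seteqP; split=> //; apply: contrapT => KJ.
  by apply: noK; exists (exist _ K (conj PK (subset_trans IJ JK))).
have [f Hf] := choice step.
pose F n := iter n f (exist _ I (conj PI (@subset_refl _ I))).
have [n|n|N HN] := accA (fun n => sval (F n)).
- by apply: idP; case: (svalP (F n)).
- by have [] := Hf (F n).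
by have [_ []] := Hf (F N); apply: HN N.+1.
Qed.

Definition lead_ideal (R : comNzRingType) (I : set {poly R}) n : set R :=
  [set a | exists p, [/\ I p, (size p <= n.+1)%N & p`_n = a]].

Lemma ideal_lead_ideal (R : comNzRingType) (I : set {poly R}) n :
  ideal I -> ideal (lead_ideal I n).
Proof.
move=> [I0 ID IM]; split=> [|_ _ [p [Ip szp <-]] [q [Iq szq <-]]|
         c _ [p [Ip szp <-]]].
- by exists 0; rewrite size_poly0 coef0.
- exists (p + q); rewrite coefD; split=> //; first exact: ID.
  by apply: leq_trans (size_polyD _ _) _; rewrite geq_max szp.
- exists (c%:P * p); rewrite coefCM; split=> //; first exact: IM.
  by rewrite mul_polyC; apply: leq_trans (size_scale_leq _ _) _.
Qed.

Lemma lead_idealS (R : comNzRingType) (I : set {poly R}) n :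
  ideal I -> lead_ideal I n `<=` lead_ideal I n.+1.
Proof.
move=> [_ _ IM] _ [p [Ip szp <-]]; exists ('X * p); split; first exact: IM.
  rewrite mulrC; apply: leq_trans (size_polyMleq _ _) _.
  by rewrite size_polyX; lia.
by rewrite coefXM.
Qed.

Lemma lead_ideal_sub (R : comNzRingType) (I J : set {poly R}) n :
  I `<=` J -> lead_ideal I n `<=` lead_ideal J n.
Proof. by move=> IJ a [p [/IJ Jp szp pn]]; exists p. Qed.

(** Induction on the size: subtracting from [p] an element of [I] with the same coefficient in
    degree [n] lowers the size. *)
Lemma lead_ideal_inj (R : comNzRingType) (I J : set {poly R}) :
    ideal I -> ideal J -> I `<=` J ->
  (forall n, lead_ideal J n `<=` lead_ideal I n) -> J `<=` I.
Proof.
move=> [I0 ID _] idJ IJ leadJI p Jp; have [_ JD _] := idJ.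
move: {2}(size p) (leqnn (size p)) => n; elim: n p Jp => [|n IHn] p Jp.
  by rewrite leqn0 size_poly_eq0 => /eqP ->.
move=> szp; have [|q [Iq szq qp]] := leadJI n p`_n; first by exists p.
rewrite -(subrK q p); apply: (ID) => //; apply: IHn.
  by apply: JD => //; apply: ideal_opp => //; apply: IJ.
apply/leq_sizeP => j; rewrite leq_eqVlt => /orP[/eqP <-|lt_nj].
  by rewrite coefB qp subrr.
rewrite coefB !nth_default ?subrr //; first exact: leq_trans szq lt_nj.
exact: leq_trans szp lt_nj.
Qed.

(* Hilbert's basis theorem, through the doubly indexed family of ideals of
   degree-n leading coefficients of the k-th ideal: its diagonal is
   stationary from some N on, and so is each of the N first rows. *)
Lemma acc_poly (R : comNzRingType) : ideal_acc R -> ideal_acc {poly R}.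
Proof.
move=> accR F idF FS; pose L k n := lead_ideal (F k) n.
have FM i j : (i <= j)%N -> F i `<=` F j by apply: chain_le.
have LM i j n : (i <= j)%N -> L i n `<=` L j n.
  by move=> /FM; apply: lead_ideal_sub.
have LN k i j : (i <= j)%N -> L k i `<=` L k j.
  by apply: chain_le => n; apply: lead_idealS.
have [n|n|N HN] := accR (fun n => L n n).
- exact: ideal_lead_ideal.
- by apply: subset_trans (LN _ _ _ (leqnSn n)) _; apply: LM.
have /choice[K HK] n : exists k, forall j, L j n `<=` L k n.
  by apply: accR => k; [apply: ideal_lead_ideal|apply: LM].
pose M := maxn N (\max_(i < N) K i); exists M => k.
have [le_kM|le_Mk] := leqP k M; first exact: FM.
apply: lead_ideal_inj => // [|n]; first by apply: FM; apply: ltnW.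
have [lt_nN|le_Nn] := ltnP n N.
  apply: subset_trans (HK n k) (LM _ _ _ _).
  by apply: leq_trans (leq_maxr _ _); apply: (leq_bigmax (Ordinal lt_nN)).
apply: subset_trans (LM _ (maxn k n) _ (leq_maxl _ _)) _.
apply: subset_trans (LN _ _ (maxn k n) (leq_maxr _ _)) _.
apply: subset_trans (HN _) _.
by apply: subset_trans (LM _ M _ (leq_maxl _ _)) _; apply: LN.
Qed.

(** * Noetherianity of the Rees algebra and the Artin-Rees lemma *)

(** The subring generated by [s] is never formed: [S] is a polynomial ring over [R], one variable
    per entry of [s], evaluated into [B]. *)
Lemma acc_adjoin (R B : comNzRingType) (f : {rmorphism R -> B})
    (P : subringClosed B) (s : seq B) :
    ideal_acc R -> (forall u, f u \in P) -> {subset s <= P} ->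
  exists (S : comNzRingType) (g : {rmorphism S -> B}),
    [/\ ideal_acc S, forall u, g u \in P, forall u, exists v, g v = f u
      & forall b, b \in s -> exists v, g v = b].
Proof.
elim: s => [|b s IHs] accR fP sP; first by exists R, f; split=> // u; exists u.
have [|S [g [accS gP fg sg]]] := IHs accR fP.
  by move=> c cs; apply: sP; rewrite inE cs orbT.
have cgb : commr_rmorph g b by move=> u; apply: mulrC.
exists {poly S}, (horner_morph cgb); split.
- exact: acc_poly.
- move=> p; rewrite /= /horner_morph horner_coef; apply: rpred_sum => i _.
  by rewrite coef_map rpredM ?gP ?rpredX // sP ?mem_head.
- by move=> u; have [v <-] := fg u; exists v%:P; exact: horner_morphC.
- move=> c; rewrite inE => /orP[/eqP ->|/sg[v <-]].
    by exists 'X; exact: horner_morphX.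
  by exists v%:P; exact: horner_morphC.
Qed.

(** The Rees algebra is generated over [A] by the [y * 'X] with [y] a generator of [I], so it is the
    image of a polynomial ring over [A]. *)
Lemma noetherian_rees (A : comNzRingType) (I : set A) :
    noetherian A -> ideal I ->
  exists (S : comNzRingType) (g : {rmorphism S -> {poly A}}),
    [/\ ideal_acc S, forall u, g u \in rees_pred I
      & forall n a, ideal_exp I n a -> exists v, g v = a%:P * 'X^n].
Proof.
move=> noethA idI; have [s Is] := noethA I idI.
have sI y : y \in s -> I y by rewrite Is => ys; apply: sub_gen_smallest.
have CP (c : A) : c%:P \in rees_pred I.
  apply/rees_predP => i; rewrite coefC.
  by case: i => [//|i] /=; case: (ideal_ideal_exp I i.+1).
have [y|S [g [accS gP Cg sg]]] :=
    @acc_adjoin A {poly A} (polyC : {rmorphism _ -> _})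
    (rees_pred I : subringClosed _) [seq y%:P * 'X | y <- s]
    (noetherian_acc noethA) CP.
  move=> /mapP[z zs ->]; apply/rees_predP => i; rewrite coefCM coefX.
  case: i => [|[|i]] //=.
    suff: ideal_exp I 1 z by rewrite mulr1.
    by rewrite (ideal_exp1 idI); apply: sI.
  by rewrite mulr0; case: (ideal_ideal_exp I i.+2).
exists S, g; split=> //.
have idg n : ideal [set a | exists v, g v = a%:P * 'X^n].
  split=> /= [|a b [v Hv] [w Hw]|c a [v Hv]].
  - by exists 0; rewrite rmorph0 mul0r.
  - by exists (v + w); rewrite rmorphD Hv Hw polyCD mulrDl.
  - have [w Hw] := Cg c; exists (w * v).
    by rewrite rmorphM Hv Hw polyCM mulrA.
have Ig a : I a -> exists v, g v = a%:P * 'X.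
  rewrite Is; apply: ideal_gen_sub (idg 1%N) _ a => y ys.
  by apply: sg; apply: map_f ys.
elim=> [|n IHn] a.
  by move=> _; have [v Hv] := Cg a; exists v; rewrite Hv expr0 mulr1.
apply: ideal_mul_sub (idg n.+1) _ a => y b /Ig[v Hv] /IHn[w Hw].
by exists (v * w); rewrite rmorphM Hv Hw polyCM exprS mulrACA.
Qed.

Lemma ideal_exp_le (A : comNzRingType) (I : set A) i j :
  (i <= j)%N -> ideal_exp I j `<=` ideal_exp I i.
Proof.
move=> /subnKC <-; elim: (j - i)%N => [|k IHk]; first by rewrite addn0.
rewrite addnS /= ideal_mulC.
by apply: subset_trans (ideal_mul_subr (ideal_ideal_exp _ _)) _.
Qed.

(* The elements of the Rees algebra whose n-th coefficient is in
   x I^(n - c), for all n, form an ideal; these ideals increase with c, hence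
   are stationary. *)
Lemma artin_rees (A : comNzRingType) (I : set A) (x : A) :
    noetherian A -> ideal I -> GRing.lreg x ->
  exists c, forall n z, ideal_exp I (n + c) (x * z) -> ideal_exp I n z.
Proof.
move=> noethA idI xreg; have [S [g [accS gP Ig]]] := noetherian_rees noethA idI.
pose F c : set S := [set u | forall n, exists2 z, ideal_exp I (n - c) z
                                              & (g u)`_n = x * z].
have [c|c|N HN] := accS F.
- split=> [n|u v Hu Hv n|u v Hv n].
  + exists 0; first by case: (ideal_ideal_exp I (n - c)).
    by rewrite rmorph0 coef0 mulr0.
  + have [y Hy uy] := Hu n; have [z Hz vz] := Hv n; exists (y + z).
      by have [_ ID _] := ideal_ideal_exp I (n - c); apply: ID.
    by rewrite rmorphD coefD uy vz mulrDr.
  + rewrite rmorphM coefM /=.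
    apply: (big_ind (fun a => exists2 z, _ z & a = x * z)).
    * exists 0; rewrite ?mulr0 //; first by case: (ideal_ideal_exp I (n - c)).
    * move=> _ _ [y Hy ->] [z Hz ->]; exists (y + z); rewrite ?mulrDr //.
      by have [_ ID _] := ideal_ideal_exp I (n - c); apply: ID.
    * move=> i _; have [z Hz ->] := Hv (n - i)%N.
      exists ((g u)`_i * z); last by rewrite mulrCA.
      have /rees_predP/(_ i) Hu := gP u.
      apply: ideal_exp_le (mem_ideal_expD Hu Hz); lia.
- move=> u Hu n; have [z Hz uz] := Hu n; exists z => //.
  by apply: ideal_exp_le Hz; lia.
exists N => n z Hz; have [v Hv] := Ig _ _ Hz.
(* The image of [v] is [x * z] in degree [n + N] and 0 elsewhere; at index [n + N] the required
   power of [I] is the 0-th, so membership is free. Stationarity then moves [v] into [F N]. *)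
have : F (n + N)%N v.
  move=> i; rewrite Hv coefCM coefXn; case: eqP => [->|_]; last first.
    by exists 0; rewrite ?mulr0 //; case: (ideal_ideal_exp I (i - (n + N))).
  by exists z; rewrite ?mulr1 // subnn.
move=> /HN/(_ (n + N)%N)[w]; rewrite addnK Hv coefCM coefXn eqxx mulr1.
by move=> Hw /xreg ->.
Qed.

(** * Lengths of quotients, measured by chains of ideals *)

(** For an ideal [J], the length of A/J is the supremum of the [n] with [ideal_chain J n]; this
    avoids quotient modules. *)
Inductive ideal_chain (A : comNzRingType) : set A -> nat -> Prop :=
| IdealChain0 J : ideal_chain J 0
| IdealChainS J K n :
    ideal K -> J `<` K -> ideal_chain K n -> ideal_chain J n.+1.

Lemma ideal_chain_sub (A : comNzRingType) (J K : set A) n :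
  J `<=` K -> ideal_chain K n -> ideal_chain J n.
Proof.
move=> + cK; case: cK J => [K' J _|K' L n' idL [KL nLK] cL J JK].
  exact: IdealChain0.
apply: IdealChainS cL => //; split; first exact: subset_trans KL.
by move=> LJ; apply: nLK; apply: subset_trans JK.
Qed.

Lemma ideal_chainT (A : comNzRingType) n : ideal_chain [set: A] n -> n = 0%N.
Proof.
move eJ: setT => J cJ; case: cJ eJ => // K L k _ [_ nLK] _ TK.
by case: nLK; rewrite -TK.
Qed.

Definition add_scale (A : comNzRingType) (J : set A) (x : A) (L : set A) :=
  [set z | exists u a, [/\ J u, L a & z = u + a * x]].

Lemma ideal_add_scale (A : comNzRingType) (J : set A) x (L : set A) :
  ideal J -> ideal L -> ideal (add_scale J x L).
Proof.
move=> [J0 JD JM] [L0 LD LM].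
split=> [|_ _ [u [a [Ju La ->]]] [v [b [Jv Lb ->]]]|c _ [u [a [Ju La ->]]]].
- by exists 0, 0; rewrite mul0r addr0.
- exists (u + v), (a + b); split; [exact: JD|exact: LD|].
  by rewrite mulrDl addrACA.
- exists (c * u), (c * a); split; [exact: JM|exact: LM|].
  by rewrite mulrDr mulrA.
Qed.

Lemma add_scaleS (A : comNzRingType) (J K : set A) x (L M : set A) :
  J `<=` K -> L `<=` M -> add_scale J x L `<=` add_scale K x M.
Proof.
move=> JK LM _ [u [a [Ju La ->]]].
by exists u, a; split; [apply: JK|apply: LM|].
Qed.

Lemma sub_add_scale (A : comNzRingType) (J : set A) x (L : set A) :
  ideal L -> J `<=` add_scale J x L.
Proof. by move=> [L0 _ _] u Ju; exists u, 0; rewrite mul0r addr0. Qed.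

(* The next two lemmas say that lengths are additive along the exact sequence
   0 -> A/(J : x) -> A/J -> A/(J + x A) -> 0, where (J : x) is
   [set z | J (z * x)] and J + x A is [add_scale J x setT]. *)
Lemma ideal_chain_split (A : comNzRingType) (J : set A) x n :
    ideal J -> ideal_chain J n ->
  exists a b, [/\ n = (a + b)%N, ideal_chain (add_scale J x setT) a
                & ideal_chain [set z | J (z * x)] b].
Proof.
move=> idJ cJ; elim: cJ idJ => [K _|K L k idL [KL nLK] _ IHk idK].
  by exists 0%N, 0%N; split=> //; apply: IdealChain0.
have [a [b [-> ca cb]]] := IHk idL.
(* By the modular law, a strict step from [K] to [L] is strict after adding x A or after taking (_ :
   x); it is counted in [b] if the sums with x A agree, otherwise in [a]. *)
have [sLK|nsLK] := pselect (add_scale L x setT `<=` add_scale K x setT).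
  exists a, b.+1; rewrite addnS; split=> //.
    by apply: ideal_chain_sub ca; apply: add_scaleS.
  apply: IdealChainS cb; first exact: ideal_colon.
  split=> [z /KL //|cLK]; apply: nLK => z Lz.
  have [_ KD _] := idK; have [_ LD _] := idL.
  have [u [c [Ku _ zE]]] := sLK z (sub_add_scale x (ideal_setT A) Lz).
  rewrite zE; apply: KD => //; apply: cLK => /=.
  have -> : c * x = z + (- u) by rewrite zE addrAC subrr add0r.
  by apply: LD => //; apply: ideal_opp => //; apply: KL.
exists a.+1, b; split=> //.
  apply: IdealChainS ca; first exact: ideal_add_scale (ideal_setT A).
  by split=> //; apply: add_scaleS.
by apply: ideal_chain_sub cb => z /KL.
Qed.

Lemma ideal_chain_join (A : comNzRingType) (J : set A) x a b :
    ideal J -> ideal_chain (add_scale J x setT) a ->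
    ideal_chain [set z | J (z * x)] b ->
  ideal_chain J (a + b).
Proof.
move=> idJ ca cb; have [J0 JD _] := idJ.
(* On ideals containing (J : x), the map from [L] to J + x L is strictly increasing; the image of
   the chain ends inside J + x A, where the chain of length [a] takes over. *)
suff H L : ideal L -> [set z | J (z * x)] `<=` L -> ideal_chain L b ->
    ideal_chain (add_scale J x L) (a + b).
  have idC : ideal [set z | J (z * x)] by apply: ideal_colon.
  apply: ideal_chain_sub (H _ idC (@subset_refl _ _) cb).
  exact: sub_add_scale.
move=> + + cL; elim: cL => [M idM JM|M K k idK [MK nKM] _ IHk idM JM].
  by rewrite addn0; apply: ideal_chain_sub ca; apply: add_scaleS.
rewrite addnS; apply: IdealChainS (IHk idK (subset_trans JM MK)).
  exact: ideal_add_scale.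
split=> [|sKM]; first exact: add_scaleS.
apply: nKM => c Kc; have [|u [d [Ju Md cE]]] := sKM (c * x).
  by exists 0, c; rewrite add0r.
have [_ MD _] := idM; rewrite -(subrK d c); apply: MD => //; apply: JM => /=.
by rewrite mulrBl cE addrK.
Qed.

Lemma ideal_chain_exp (A : comNzRingType) (I : set A) (s : seq A) :
    I = ideal_gen [set` s] -> (forall l, ideal_chain I l -> (l <= 1)%N) ->
  forall n l, ideal_chain (ideal_exp I n) l -> (l <= n ^ size s)%N.
Proof.
move=> Is Il n l cl.
have idI : ideal I by rewrite Is; apply: ideal_ideal_gen.
have sI y : y \in s -> I y by rewrite Is => ys; apply: sub_gen_smallest.
suff H (t : seq A) (J : nat -> set A) : {subset t <= s} ->
    (forall k, ideal (J k)) -> J 0%N = setT ->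
    (forall k y z, J k z -> I y -> J k.+1 (z * y)) ->
    (forall k y, y \in s -> (y \in t) || `[< J k y >]) ->
    forall k i, ideal_chain (J k) i -> (i <= k ^ size t)%N.
  apply: H cl => //; first by move=> k; apply: ideal_ideal_exp.
    by move=> k y z Hz Iy; rewrite mulrC; apply: mem_ideal_mul.
  by move=> k y ->.
elim: t J => [|y t IHt] J ts idJ J0 JI sJ k i ci.
  apply: Il; apply: ideal_chain_sub ci; rewrite Is.
  by apply: ideal_gen_sub => // y /(sJ k) /= /asboolP.
elim: k i ci => [|k IHk] i; first by rewrite J0 => /ideal_chainT ->.
move=> /(ideal_chain_split y (idJ k.+1))[a [b [-> ca cb]]].
have le_a : (a <= k.+1 ^ size t)%N.
  apply: (IHt (fun k => add_scale (J k) y setT)) ca.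
  - by move=> z zt; apply: ts; rewrite inE zt orbT.
  - by move=> j; apply: ideal_add_scale (ideal_setT A).
  - apply/seteqP; split=> // z _; rewrite J0.
    by exists z, 0; rewrite mul0r addr0.
  - move=> j z _ [u [c [Ju _ ->]]] Iz; exists (u * z), (c * z); split=> //.
      exact: JI.
    by rewrite mulrDl mulrAC.
  - move=> j z /(sJ j); rewrite inE => /orP[/orP[/eqP ->|->//]|/asboolP Jz].
      apply/orP; right; apply/asboolP; exists 0, 1; rewrite add0r mul1r.
      by split=> //; case: (idJ j).
    by apply/orP; right; apply/asboolP; apply: (sub_add_scale y (ideal_setT A)).
have le_b : (b <= k ^ (size t).+1)%N.
  apply: IHk; apply: ideal_chain_sub cb => z Jz; apply: JI => //.
  by apply: sI; apply: ts; apply: mem_head.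
have le_k : (k ^ size t <= k.+1 ^ size t)%N.
  by case: (size t) => // e; rewrite leq_exp2r.
rewrite /= expnS mulSn leq_add // (leq_trans le_b) // expnS.
by rewrite leq_mul2l le_k orbT.
Qed.

Lemma ideal_chain_max (A : comNzRingType) (J : set A) B :
    (forall l, ideal_chain J l -> (l <= B)%N) ->
  exists l, ideal_chain J l /\ forall k, ideal_chain J k -> (k <= l)%N.
Proof.
move=> HB; have ex : exists l, `[< ideal_chain J l >].
  by exists 0%N; apply/asboolP; apply: IdealChain0.
have ub l : `[< ideal_chain J l >] -> (l <= B)%N by move=> /asboolP/HB.
exists (ex_maxn ex ub); case: ex_maxnP => l /asboolP cl Hl; split=> // k ck.
by apply: Hl; apply/asboolP.
Qed.

(** Passing from J to (J : x) lowers the exponent [j] by one and costs at most [g]; the bound [g]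
    persists because J is contained in (J : x). *)
Lemma ideal_chain_pow (A : comNzRingType) (J : set A) x g j :
    ideal J -> (forall l, ideal_chain (add_scale J x setT) l -> (l <= g)%N) ->
    J (x ^+ j) -> forall l, ideal_chain J l -> (l <= j * g)%N.
Proof.
elim: j J => [|j IHj] J idJ Hg Jx l.
  suff -> : J = setT by move=> /ideal_chainT ->.
  apply/seteqP; split=> // z _; rewrite -[z]mulr1.
  by case: idJ => _ _; apply.
move=> /(ideal_chain_split x idJ)[a [b [-> /Hg le_a cb]]].
rewrite mulSn leq_add //; apply: IHj cb; first exact: ideal_colon.
  move=> k ck; apply: Hg; apply: ideal_chain_sub ck.
  apply: add_scaleS => // z Jz.
  by rewrite /= mulrC; case: idJ => _ _; apply.
by rewrite /= -exprSr.
Qed.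

(** * Growth of lengths and integral closures of powers *)

(** On the block of r + 1 indices starting at (r + 1) j, each step multiplies [h] by at least (c + j
    + 1) / (c + j). These factors telescope to growth of degree r + 1 in j, against a bound of
    degree r. *)
Lemma superpolynomial_growth (h : nat -> nat) (b c r : nat) :
    (forall i, (0 < i)%N -> (0 < h i)%N) ->
    (forall i, (h i <= (b * i) ^ r)%N) ->
    (forall i j, (i < r.+1 * j)%N ->
      ((c + j) * h i + h i.+1 <= (c + j) * h i.+1)%N) ->
  False.
Proof.
move=> h0 hr hS.
have step j t : (t <= r.+1)%N ->
    ((c + j).+1 ^ t * h (r.+1 * j) <= (c + j) ^ t * h (r.+1 * j + t))%N.
  elim: t => [|t IHt] le_t; first by rewrite addn0.
  have lt_t : (r.+1 * j + t < r.+1 * j.+1)%N by rewrite mulnS addnC ltn_add2r.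
  have hSt i : (i < r.+1 * j.+1)%N -> ((c + j).+1 * h i <= (c + j) * h i.+1)%N.
    by move=> /hS; rewrite addnS !mulSn; lia.
  rewrite !expnS -mulnA (leq_trans (leq_mul (leqnn _) (IHt (ltnW le_t)))) //.
  rewrite mulnCA (mulnC (c + j)%N) -mulnA addnS leq_mul2l.
  by rewrite hSt ?orbT.
pose H j := h (r.+1 * j)%N.
(* The product starts at block 1, since [h 0] may vanish. *)
have grow j : ((c + j).+1 ^ r.+1 * H 1%N <= c.+1 ^ r.+1 * H j.+1)%N.
  elim: j => [|j IHj]; first by rewrite addn0.
  have := step j.+1 _ (leqnn _).
  rewrite -[(r.+1 * j.+1 + _)%N]addnC -mulnS -/(H _).
  rewrite -/(H j.+2) addnS => Hj.
  rewrite -(@leq_pmul2l ((c + j).+1 ^ r.+1)) ?expn_gt0 //.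
  rewrite mulnCA (leq_trans (leq_mul (leqnn _) IHj)) // mulnCA [leqRHS]mulnCA.
  by rewrite leq_mul2l Hj orbT.
(* With this [j], the upper bound becomes j (j + 1) ^ r, which is below (c + j + 1) ^ (r + 1). *)
pose j := (c.+1 ^ r.+1 * (b * r.+1) ^ r)%N.
have := grow j; apply/negP; rewrite -ltnNge.
apply: leq_ltn_trans (leq_mul (leqnn _) (hr _)) _.
rewrite mulnA expnMn mulnA -/j.
apply: (@leq_trans ((c + j).+1 ^ r.+1)); last by rewrite leq_pmulr // h0.
rewrite expnS; apply: (@leq_trans ((c + j).+1 * j.+1 ^ r)).
  by rewrite ltn_pmul2r ?expn_gt0 // ltnS leq_addl.
rewrite leq_mul2l; apply/orP; right.
by case: r {hr hS step H grow} @j => // r j; rewrite leq_exp2r // ltnS leq_addl.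
Qed.

Lemma integral_closure_expr (A : comNzRingType) (I : set A) x :
    integral_closure I x ->
  exists c, forall j, ideal_exp I j (x ^+ (c + j)).
Proof.
move=> [n [a [n_gt0 Ia xn]]]; exists n => j.
(* Strong induction: the integral equation rewrites x ^ k through the a_i x ^ (k - i), with a_i in I
   ^ i. For k < n the truncated exponent is 0. *)
suff H k : ideal_exp I (k.+1 - n) (x ^+ k).
  by apply: ideal_exp_le (H (n + j)%N); lia.
elim/ltn_ind: k => k IHk; have [lt_kn|le_nk] := ltnP k n.
  by apply: (@ideal_exp_le _ _ _ 0) => //; lia.
have [_ ID IM] := ideal_ideal_exp I (k.+1 - n).
have -> : x ^+ k = - \sum_(1 <= i < n.+1) a i * x ^+ (k - i).
  rewrite -(subnKC le_nk) exprD; move/eqP: xn; rewrite addr_eq0 => /eqP ->.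
  rewrite mulNr mulr_suml; congr (- _); apply: eq_big_nat => i /andP[_ le_in].
  by rewrite -mulrA -exprD addnC addnBA // addnC.
apply: ideal_opp; first exact: ideal_ideal_exp.
rewrite big_nat; apply: (big_ind (ideal_exp I (k.+1 - n))) => //.
  by case: (ideal_ideal_exp I (k.+1 - n)).
move=> i /andP[i_gt0 le_in]; have lt_ik : (k - i < k)%N by lia.
have ai : ideal_exp I i (a i) by apply: Ia; rewrite i_gt0.
by apply: ideal_exp_le (mem_ideal_expD ai (IHk _ lt_ik)); lia.
Qed.

Lemma ideal_exp_exp (A : comNzRingType) (I : set A) i j :
  ideal_exp (ideal_exp I i) j `<=` ideal_exp I (i * j).
Proof.
elim: j => [|j IHj]; first by rewrite muln0.
apply: ideal_mul_sub; first exact: ideal_ideal_exp.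
by move=> x y Hx /IHj Hy; rewrite mulnS; apply: mem_ideal_expD.
Qed.

Lemma lreg_notin_closure_exp (A : comNzRingType) (m : set A) (x : A) :
    noetherian A -> maximal_ideal m -> GRing.lreg x ->
  exists k, ~ integral_closure (ideal_exp m k) x.
Proof.
move=> noethA [idm mT maxm] xreg; have [s ms] := noethA m idm.
have [c0 Hc0] := artin_rees noethA idm xreg.
(* The successor keeps [c] positive. The factor r + 1 in [k] puts x ^ (C + j) in m ^ (c (i + 1)) for
   all i < (r + 1) j. *)
pose c := c0.+1; pose r := size s; pose k := (c * r.+1)%N; exists k.
move=> /integral_closure_expr[C HC].
have m1 l : ideal_chain m l -> (l <= 1)%N.
  case: l => // l cl; inversion cl as [|? K ? idK [mK Km] cK]; subst.
  have [KE|KT] := maxm K idK mK; first by case: Km; rewrite KE.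
  by move: cK; rewrite KT => /ideal_chainT ->.
have mle n l : ideal_chain (ideal_exp m n) l -> (l <= n ^ r)%N.
  exact: ideal_chain_exp ms m1 n l.
have /choice[f Hf] n := ideal_chain_max (mle n).
have [||i j lt_ij] := @superpolynomial_growth (fun i => f (c * i)%N) c C r.
- move=> i i_gt0; have [_] := Hf (c * i)%N; apply.
  apply: IdealChainS (IdealChain0 _); first exact: ideal_setT.
  split=> // Tm; case/eqP: mT; apply/seteqP; split=> // z /Tm.
  rewrite -{2}(ideal_exp1 idm); apply: ideal_exp_le.
  by rewrite muln_gt0 i_gt0.
- by move=> i; apply: mle; have [] := Hf (c * i)%N.
pose J := ideal_exp m (c * i.+1)%N.
have idJ : ideal J by apply: ideal_ideal_exp.
have [g [cg Hg]] : exists g, ideal_chain (add_scale J x setT) g /\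
    forall l, ideal_chain (add_scale J x setT) l -> (l <= g)%N.
  apply: (@ideal_chain_max _ _ (f (c * i.+1)%N)) => l cl.
  have [_] := Hf (c * i.+1)%N; apply; apply: ideal_chain_sub cl.
  exact: sub_add_scale (ideal_setT A).
have le_f : (f (c * i.+1)%N <= (C + j) * g)%N.
  apply: (ideal_chain_pow idJ Hg); last by have [] := Hf (c * i.+1)%N.
  apply: ideal_exp_le (ideal_exp_exp (HC j)).
  by rewrite /k -mulnA leq_mul2l lt_ij orbT.
(* Artin-Rees puts (J : x) inside m ^ (c i), so additivity of lengths bounds [g] by the increment of
   [f] from c i to c (i + 1). *)
have le_g : (g + f (c * i) <= f (c * i.+1))%N.
  have [_] := Hf (c * i.+1)%N; apply; apply: ideal_chain_join cg _ => //.
  have [ci _] := Hf (c * i)%N; apply: ideal_chain_sub ci => z /= Jz.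
  by apply: Hc0; rewrite mulrC; apply: ideal_exp_le Jz; rewrite mulnS; lia.
rewrite addnC (leq_trans (leq_add le_f (leqnn _))) // -mulnDr.
by rewrite leq_mul2l le_g orbT.
Qed.

(** * Factorizations in the monoid of integrally closed ideals *)

(** A longest factorization into elements other than 1 consists of atoms: splitting a reducible
    entry would lengthen it. *)
Lemma bounded_BFM (M : monoidType) :
    commutative_monoid M -> reduced_monoid M ->
    (forall x : M, exists B, forall s : seq M,
      (forall a, a \in s -> a <> 1%g) ->
      x = (\prod_(a <- s) a)%g -> (size s <= B)%N) ->
  BFM M.
Proof.
move=> MC M1 MB; split=> // x; have [B HB] := MB x; last first.
  apply: (@sub_finite_set _ _ `I_B.+1); last exact: finite_II.
  by move=> _ [s [sA xE] <-]; rewrite /= ltnS; apply: HB => // a /sA[].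
pose P k := `[< exists s : seq M, [/\ size s = k, forall a, a \in s -> a <> 1%g
                                     & x = (\prod_(a <- s) a)%g] >].
have exP : exists k, P k.
  have [x1|x1] := pselect (x = 1%g).
    by exists 0%N; apply/asboolP; exists [::]; rewrite big_nil.
  exists 1%N; apply/asboolP; exists [:: x]; rewrite big_seq1; split=> // a.
  by rewrite inE => /eqP ->.
have ubP k : P k -> (k <= B)%N by move=> /asboolP[s [<- s1 xE]]; apply: HB.
have [k /asboolP[s [sk s1 xE]] kmax] := ex_maxnP exP ubP.
exists s; split=> // a sa; split=> [|y z ayz]; first exact: s1.
apply: contrapT => /not_orP[y1 z1].
case/splitPr: sa sk s1 xE => s1' s2' sk s1 xE.
suff /kmax : P k.+1 by rewrite ltnn.
apply/asboolP; exists (s1' ++ [:: y, z & s2']); split.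
- by rewrite -sk !size_cat /= !addnS.
- move=> b bs; have [->//|by_] := eqVneq b y; have [->//|bz] := eqVneq b z.
  apply: s1; move: bs; rewrite !mem_cat !inE (negPf by_) (negPf bz).
  by case/orP=> /= ->; rewrite ?orbT.
rewrite xE; elim: s1' {xE sk s1} => [|b t IHt]; last first.
  by rewrite /= !big_cons IHt.
by rewrite !big_cons ayz mulgA.
Qed.

Lemma proper_sub_maximal (A : comNzRingType) (m I : set A) :
    noetherian A -> (forall n, maximal_ideal n -> n = m) -> ideal I -> ~ I 1 ->
  I `<=` m.
Proof.
move=> noethA locm idI I1.
pose P (J : set A) := ideal J /\ ~ J 1.
have [|M [[idM M1] IM] Mmax] :=
  @acc_maximal A P I (noetherian_acc noethA) _ (conj idI I1).
  by move=> J [].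
rewrite -(locm M) //; split=> // [|J idJ MJ].
  by apply/eqP => MT; apply: M1; rewrite MT.
have [J1|nJ1] := pselect (J 1); last by left; apply: Mmax.
right; apply/seteqP; split=> // z _; rewrite -[z]mulr1.
by case: idJ => _ _; apply.
Qed.

Lemma ic_prod_sub (A : comNzRingType) (m : set A) (s : seq (ic A)) :
    (forall I : ic A, I \in s -> I `<=` m) ->
  (\prod_(I <- s) I)%g `<=` integral_closure (ideal_exp m (size s)).
Proof.
elim: s => [|I s IHs] sm.
  by rewrite big_nil /= ic_one_closed.
rewrite big_cons /= => z Hz.
apply: integral_closureK; first exact: ideal_ideal_mul.
apply: integral_closureS Hz.
(* [integral_closure_mul] extracts a closure from the left factor only, hence the swap. *)
rewrite [X in X `<=` _]ideal_mulC [ideal_mul m _]ideal_mulC.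
apply: subset_trans (@integral_closure_mul _ _ _).
apply: ideal_mulS; last by apply: sm; apply: mem_head.
by apply: IHs => J Js; apply: sm; rewrite inE Js orbT.
Qed.

Theorem theorem3p10 (A : comNzRingType) (m : set A) :
  regular_local m -> BFM (ic A).
Proof.
move=> [noethA maxm locm _].
apply: bounded_BFM; [exact: ic_commutative|exact: ic_reduced|] => I.
have [x Ix xreg] := ic_regular I.
have [k Hk] := lreg_notin_closure_exp noethA maxm xreg.
(* With more than [k] factors, all inside [m], the element [x] of [I] would be integral over m ^
   k. *)
exists k => s s1 IE; rewrite leqNgt; apply/negP => lt_ks.
apply: Hk; apply: (@integral_closureS _ (ideal_exp m (size s))).
  exact/ideal_exp_le/ltnW.
apply: ic_prod_sub; last by rewrite -IE.
move=> J /s1 J1; apply: proper_sub_maximal => //; first exact: ic_ideal.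
move=> J1'; apply: J1; apply: ic_inj; apply/seteqP; split=> // z _.
by rewrite -[z]mulr1; case: (ic_ideal J) => _ _; apply.
Qed.
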